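(* Let $m$ be odd and let $c$ be an integer with $1<c<m/2$ and $\gcd(c,m)=1$. Then $G_{\alpha}(m;1,1,c)$ is 3-edge-colorable.
   Context: Let $G$ be the graph with the 11 vertices $A,B,A',B',v,x_1,\dots,x_6$ and the 14 edges $Av,\ vA',\ Ax_6,\ x_6x_2,\ x_6x_5,\ x_2x_4,\ x_2B,\ x_4x_3,\ x_4B',\ x_3A',\ x_3x_5,\ x_5x_1,\ x_1B,\ x_1B'$. For integers $m\ge 3$, $a,b$ with $1\le a,b\le m-1$ and $1\le c<m/2$, $G_{\alpha}(m;a,b,c)$ is the cubic graph with vertex set $\{u_i: u\in V(G),\ i\in\mathbb{Z}_m\}\cup\{w_i: i\in\mathbb{Z}_m\}$ and edges $u_iu'_i$ for every edge $uu'$ of $G$, spoke edges $v_iw_i$, loop edges $w_iw_{i+c}$, and connecting edges $A'_iA_{i+a}$, $B'_iB_{i+b}$ (indices mod $m$). *)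

(* Defs.v *)
From HB Require Import structures.
From mathcomp Require Import all_boot.

Set Implicit Arguments.
Unset Strict Implicit.
Unset Printing Implicit Defensive.

Section EdgeColoring.
Variables (T : finType) (e : rel T).

Definition edges : {set {set T}} := [set [set p.1; p.2] | p : T * T & e p.1 p.2].

Definition edge_colorable (k : nat) : Prop :=
  exists f : {set T} -> 'I_k,
    {in edges &, forall E F, E != F -> E :&: F != set0 -> f E != f F}.

End EdgeColoring.

Inductive base_vertex : Set :=
  vA | vB | vA' | vB' | vv | vx1 | vx2 | vx3 | vx4 | vx5 | vx6.

Definition base_vertices : seq base_vertex :=
  [:: vA; vB; vA'; vB'; vv; vx1; vx2; vx3; vx4; vx5; vx6].

Definition base_vertex_rank (u : base_vertex) : 'I_11 :=
  match u with
  | vA => @Ordinal 11 0 isT | vB => @Ordinal 11 1 isT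
  | vA' => @Ordinal 11 2 isT | vB' => @Ordinal 11 3 isT
  | vv => @Ordinal 11 4 isT | vx1 => @Ordinal 11 5 isT
  | vx2 => @Ordinal 11 6 isT | vx3 => @Ordinal 11 7 isT
  | vx4 => @Ordinal 11 8 isT | vx5 => @Ordinal 11 9 isT
  | vx6 => @Ordinal 11 10 isT
  end.

Lemma base_vertex_rankK :
  cancel base_vertex_rank (fun i : 'I_11 => nth vA base_vertices i).
Proof. by case. Qed.

HB.instance Definition _ := Finite.copy base_vertex (can_type base_vertex_rankK).

Definition base_edges : seq (base_vertex * base_vertex) :=
  [:: (vA, vv); (vv, vA'); (vA, vx6); (vx6, vx2); (vx6, vx5); (vx2, vx4);
      (vx2, vB); (vx4, vx3); (vx4, vB'); (vx3, vA'); (vx3, vx5); (vx5, vx1);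
      (vx1, vB); (vx1, vB')].

(* [inl (u, i)] is the vertex u_i and [inr i] is w_i; Z_m is represented by
   the residues 'I_m. *)
Definition Galpha_vertex (m : nat) : finType :=
  ((base_vertex * 'I_m) + 'I_m)%type.

(* Each edge is listed in one direction only; [Galpha] is the symmetric
   closure. *)
Definition Galpha_arc (m a b c : nat) : rel (Galpha_vertex m) :=
  fun p q => match p, q with
  | inl (u, i), inl (u', j) =>
      [|| ((u, u') \in base_edges) && (i == j),
          [&& u == vA', u' == vA & j == (i + a) %% m :> nat]
        | [&& u == vB', u' == vB & j == (i + b) %% m :> nat]]
  | inl (u, i), inr j => (u == vv) && (i == j)
  | inr i, inr j => j == (i + c) %% m :> nat
  | inr _, inl _ => false
  end.

Definition Galpha (m a b c : nat) : rel (Galpha_vertex m) :=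
  fun p q => Galpha_arc a b c p q || Galpha_arc a b c q p.

Lemma Galpha_sym (m a b c : nat) : symmetric (@Galpha m a b c).
Proof. by move=> p q; rewrite /Galpha orbC. Qed.

Lemma Galpha_irrefl (m a b c : nat) :
  0 < c -> 2 * c < m -> irreflexive (@Galpha m a b c).
Proof.
move=> c0 cm; have ltcm : c < m by apply: leq_ltn_trans cm; rewrite leq_pmull.
move=> [[u i]|i]; rewrite /Galpha orbb /=; first by case: u.
by rewrite -[X in X == _](modn_small (ltn_ord i)) -{1}[nat_of_ord i]addn0
  eqn_modDl mod0n modn_small // eq_sym; apply: negbTE; rewrite -lt0n.
Qed.

(* Main.v *)
Require Import Defs.
From mathcomp Require Import all_boot zify.

(** Cutting the graph along the connecting edges yields [m] copies of one
block. Once the color of its spoke is fixed, a block relates the colors of the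
connecting edges entering it through [A], [B] to those of the edges leaving it
through [A'], [B'], so that a 3-edge-coloring amounts to a closed walk of length
[m] on pairs of colors whose labels are the spoke colors, together with a
compatible coloring of the loop edges.  As [gcd(c, m) = 1], the loop edges form
a single odd cycle [w_0, w_c, w_2c, ...]; color [w_0 w_c] with 2 and the other
loop edges alternately with 1 and 0.  Then the spokes at [w_0], [w_c] have
colors 1, 0, and all the others have color 2.  Blocks whose spoke has color 2 can
alternate between two states, so the required closed walk only depends on the
parity of [c]. *)

Set Implicit Arguments.
Unset Strict Implicit.
Unset Printing Implicit Defensive.

(** * Edge colorings from colorings of arcs *)

(* The last hypothesis on [col] does not exclude [y = z]: it rules out pairs of
   opposite arcs. *)
Lemma edge_colorable_arcs (T : finType) (arc : rel T) (k : nat)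
    (col : T -> T -> 'I_k.+1) :
    (forall x y z, arc x y -> arc x z -> y != z -> col x y != col x z) ->
    (forall x y z, arc y x -> arc z x -> y != z -> col y x != col z x) ->
    (forall x y z, arc x y -> arc z x -> col x y != col z x) ->
  edge_colorable (fun x y => arc x y || arc y x) k.+1.
Proof.
move=> col_out col_in col_thru.
pose arc_of E (p : T * T) := arc p.1 p.2 && (E == [set p.1; p.2]).
(* An arbitrary arc spanning [E] gives its color; [ord0] is a dummy for sets spanned by no arc. *)
exists (fun E => if [pick p | arc_of E p] is Some p then col p.1 p.2 else ord0).
have arcP E : E \in edges (fun x y => arc x y || arc y x) ->
    exists p, arc_of E p.
  case/imsetP=> -[x y]; rewrite inE /= => /orP[xy|yx] ->.
    by exists (x, y); rewrite /arc_of xy eqxx.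
  by exists (y, x); rewrite /arc_of yx setUC eqxx.
move=> E F /arcP[pE0 HE0] /arcP[pF0 HF0] neqEF /set0Pn[x].
case: pickP => [[a b]|/(_ pE0)]; last by rewrite HE0.
case: pickP => [[a' b']|/(_ pF0)]; last by rewrite HF0.
rewrite /arc_of /= => /andP[arcF /eqP EF] /andP[arcE /eqP EE].
move: neqEF; rewrite EE EF !inE => neqEF.
case/andP=> /orP[]/eqP -> /orP[]/eqP eqx.
- rewrite -eqx in arcF neqEF *; apply: col_out => //.
  by apply: contraNneq neqEF => ->.
- by rewrite -eqx in arcF *; apply: col_thru.
- by rewrite eq_sym; rewrite -eqx in arcF *; apply: col_thru.
- rewrite -eqx in arcF neqEF *; apply: col_in => //.
  by apply: contraNneq neqEF => ->.
Qed.

(** * Colorings of a single block *)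

Definition c0 : 'I_3 := @Ordinal 3 0 isT.
Definition c1 : 'I_3 := @Ordinal 3 1 isT.
Definition c2 : 'I_3 := @Ordinal 3 2 isT.

(* [s] is the color of the spoke at [v], [p] the pair of colors of the
   connecting edges at [A] and [B], and [q] of those at [A'] and [B']. *)
Definition block_proper (s : 'I_3) (p q : 'I_3 * 'I_3)
    (g : base_vertex -> base_vertex -> 'I_3) : bool :=
  all uniq
    [:: [:: p.1; g vA vv; g vA vx6]; [:: p.2; g vx2 vB; g vx1 vB];
        [:: q.1; g vv vA'; g vx3 vA']; [:: q.2; g vx4 vB'; g vx1 vB'];
        [:: s; g vA vv; g vv vA']; [:: g vx5 vx1; g vx1 vB; g vx1 vB'];
        [:: g vx6 vx2; g vx2 vx4; g vx2 vB];
        [:: g vx4 vx3; g vx3 vA'; g vx3 vx5];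
        [:: g vx2 vx4; g vx4 vx3; g vx4 vB'];
        [:: g vx6 vx5; g vx3 vx5; g vx5 vx1];
        [:: g vA vx6; g vx6 vx2; g vx6 vx5]].

Definition block_transition (s : 'I_3) (p q : 'I_3 * 'I_3) : Prop :=
  exists g, block_proper s p q g.

(** Lists the 14 colors of a block in the order of [base_edges], so that each transition is checked
    by computation. *)
Definition coloring_of (l : seq 'I_3) (u u' : base_vertex) : 'I_3 :=
  nth c0 l (index (u, u') base_edges).

(** The digits in the names are the spoke color, the pair at [A], [B], and the pair at [A'], [B'].
    As a block has 11 vertices, every color occurs an odd number of times among these five. *)
Lemma transition1_01_21 : block_transition c1 (c0, c1) (c2, c1).
Proof.
by exists (coloring_of
  [:: c2; c0; c1; c0; c2; c1; c2; c2; c0; c1; c0; c1; c0; c2]).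
Qed.

Lemma transition0_20_10 : block_transition c0 (c2, c0) (c1, c0).
Proof.
by exists (coloring_of
  [:: c1; c2; c0; c1; c2; c0; c2; c2; c1; c0; c1; c0; c1; c2]).
Qed.

Lemma transition1_21_01 : block_transition c1 (c2, c1) (c0, c1).
Proof.
by exists (coloring_of
  [:: c0; c2; c1; c0; c2; c1; c2; c2; c0; c1; c0; c1; c0; c2]).
Qed.

Lemma transition0_10_20 : block_transition c0 (c1, c0) (c2, c0).
Proof.
by exists (coloring_of
  [:: c2; c1; c0; c1; c2; c0; c2; c2; c1; c0; c1; c0; c1; c2]).
Qed.

Lemma transition2_21_20 : block_transition c2 (c2, c1) (c2, c0).
Proof.
by exists (coloring_of
  [:: c1; c0; c0; c1; c2; c0; c2; c2; c1; c1; c0; c1; c0; c2]).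
Qed.

Lemma transition2_20_21 : block_transition c2 (c2, c0) (c2, c1).
Proof.
by exists (coloring_of
  [:: c0; c1; c1; c0; c2; c1; c2; c2; c0; c0; c1; c0; c1; c2]).
Qed.

Lemma transition2_10_22 : block_transition c2 (c1, c0) (c2, c2).
Proof.
by exists (coloring_of
  [:: c0; c1; c2; c0; c1; c2; c1; c1; c0; c0; c2; c0; c2; c1]).
Qed.

Lemma transition2_22_01 : block_transition c2 (c2, c2) (c0, c1).
Proof.
by exists (coloring_of
  [:: c0; c1; c1; c0; c2; c2; c1; c1; c0; c2; c0; c1; c0; c2]).
Qed.

Lemma transition2_01_22 : block_transition c2 (c0, c1) (c2, c2).
Proof.
by exists (coloring_of
  [:: c1; c0; c2; c0; c1; c1; c2; c2; c0; c1; c0; c2; c0; c1]).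
Qed.

Lemma transition2_22_10 : block_transition c2 (c2, c2) (c1, c0).
Proof.
by exists (coloring_of
  [:: c1; c0; c0; c1; c2; c2; c0; c0; c1; c2; c1; c0; c1; c2]).
Qed.

(** With [block_in] and [block_thru], this supplies the three hypotheses of [edge_colorable_arcs]
    for two arcs inside one block. *)
Lemma block_out (s : 'I_3) p q g u u' u'' :
    block_proper s p q g -> (u, u') \in base_edges -> (u, u'') \in base_edges ->
  u' != u'' -> g u u' != g u u''.
Proof.
rewrite /block_proper /= !inE !negb_or -!andbA.
do ![case/andP=> ?] => _.
by case: u; case: u' => // _; case: u'' => // _ _; rewrite // eq_sym.
Qed.

Lemma block_in (s : 'I_3) p q g u u' u'' :
    block_proper s p q g -> (u', u) \in base_edges -> (u'', u) \in base_edges ->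
  u' != u'' -> g u' u != g u'' u.
Proof.
rewrite /block_proper /= !inE !negb_or -!andbA.
do ![case/andP=> ?] => _.
by case: u; case: u' => // _; case: u'' => // _ _; rewrite // eq_sym.
Qed.

Lemma block_thru (s : 'I_3) p q g u u' u'' :
    block_proper s p q g -> (u, u') \in base_edges -> (u'', u) \in base_edges ->
  g u u' != g u'' u.
Proof.
rewrite /block_proper /= !inE !negb_or -!andbA.
do ![case/andP=> ?] => _.
by case: u; case: u' => // _; case: u'' => // _; rewrite // eq_sym.
Qed.

Lemma block_ports (s : 'I_3) p q g u : block_proper s p q g ->
  [/\ (vA, u) \in base_edges -> g vA u != p.1,
      (u, vB) \in base_edges -> g u vB != p.2,
      (u, vA') \in base_edges -> g u vA' != q.1,
      (u, vB') \in base_edges -> g u vB' != q.2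
    & ((vv, u) \in base_edges -> g vv u != s) /\
      ((u, vv) \in base_edges -> g u vv != s)].
Proof.
rewrite /block_proper /= !inE !negb_or -!andbA.
do ![case/andP=> ?] => _.
by split; [..|split]; case: u => // _; rewrite // eq_sym.
Qed.

(** * Gluing the blocks along connecting, spoke and loop edges *)

Section Assembly.
Variables (m a b c : nat) (s sA sB lc : 'I_m -> 'I_3).
Variable g : 'I_m -> base_vertex -> base_vertex -> 'I_3.

(** A connecting edge is colored by the index of its head, a loop edge by that of its tail. *)
Variant colored_arc : Galpha_vertex m -> Galpha_vertex m -> 'I_3 -> Prop :=
| ColoredBase u u' i of (u, u') \in base_edges :
    colored_arc (inl (u, i)) (inl (u', i)) (g i u u')
| ColoredA (i j : 'I_m) of j = (i + a) %% m :> nat :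
    colored_arc (inl (vA', i)) (inl (vA, j)) (sA j)
| ColoredB (i j : 'I_m) of j = (i + b) %% m :> nat :
    colored_arc (inl (vB', i)) (inl (vB, j)) (sB j)
| ColoredSpoke i : colored_arc (inl (vv, i)) (inr i) (s i)
| ColoredLoop (i j : 'I_m) of j = (i + c) %% m :> nat :
    colored_arc (inr i) (inr j) (lc i).

Definition arc_color (p q : Galpha_vertex m) : 'I_3 :=
  match p, q with
  | inl (u, i), inl (u', j) =>
      if (u, u') \in base_edges then g i u u'
      else if u == vA' then sA j else sB j
  | inl (_, i), inr _ => s i
  | inr i, _ => lc i
  end.

Lemma arc_colorP p q : Galpha_arc a b c p q -> colored_arc p q (arc_color p q).
Proof.
case: p q => [[u i]|i] [[u' j]|j] //=; last by move/eqP; constructor.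
  case: ifP => /= [? /or3P[/eqP<-||]|_ /orP[]]; first by constructor.
  - by case/and3P=> /eqP uE /eqP u'E; subst.
  - by case/and3P=> /eqP uE /eqP u'E; subst.
  - by case/and3P=> /eqP-> /eqP-> /eqP; constructor.
  - by case/and3P=> /eqP-> /eqP-> /eqP; constructor.
by case/andP=> /eqP-> /eqP<-; constructor.
Qed.

Hypothesis g_proper : forall i jA jB : 'I_m,
  jA = (i + a) %% m :> nat -> jB = (i + b) %% m :> nat ->
  block_proper (s i) (sA i, sB i) (sA jA, sB jB) (g i).
Hypothesis lc_proper : forall i j : 'I_m,
  j = (i + c) %% m :> nat -> uniq [:: s j; lc i; lc j].

Let shift (d : nat) (i : 'I_m) : 'I_m :=
  Ordinal (ltn_pmod (i + d) (leq_ltn_trans (leq0n i) (ltn_ord i))).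

Let modD_inj (d : nat) (i j k : 'I_m) :
  k = (i + d) %% m :> nat -> k = (j + d) %% m :> nat -> i = j.
Proof.
move=> -> /eqP; rewrite eqn_modDr !modn_small // => /eqP ij.
exact: val_inj.
Qed.

Let loop_proper i : (s i != lc i) /\
  (forall j : 'I_m, i = (j + c) %% m :> nat -> (s i != lc j) && (lc i != lc j)).
Proof.
split=> [|j /lc_proper]; last first.
  by rewrite /= !inE negb_or -andbA => /and4P[-> _ + _]; rewrite eq_sym.
(* [lc_proper] compares [s i] with [lc i] only from the predecessor [i - c] of [i], which is
   therefore constructed. *)
have [j ij] : exists j : 'I_m, i = (j + c) %% m :> nat.
  exists (shift (m - c %% m) i) => /=.
  have m_gt0 : 0 < m by apply: leq_ltn_trans (ltn_ord i).
  rewrite -modnDmr modnDml -addnA subnK; last by rewrite ltnW // ltn_pmod.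
  by rewrite modnDr modn_small.
by have /= := lc_proper ij; rewrite !inE negb_or -andbA => /and4P[].
Qed.

Lemma edge_colorable_blocks : edge_colorable (@Galpha m a b c) 3.
Proof.
have gi i := g_proper (i := i) (jA := shift a i) (jB := shift b i) erefl erefl.
have gA i u : (vA, u) \in base_edges -> g i vA u != sA i.
  by case: (block_ports u (gi i)).
have gB i u : (u, vB) \in base_edges -> g i u vB != sB i.
  by case: (block_ports u (gi i)).
have gA' (i j : 'I_m) u : j = (i + a) %% m :> nat ->
    (u, vA') \in base_edges -> g i u vA' != sA j.
  by move=> ij; case: (block_ports u (g_proper (jB := shift b i) ij erefl)).
have gB' (i j : 'I_m) u : j = (i + b) %% m :> nat ->
    (u, vB') \in base_edges -> g i u vB' != sB j.
  by move=> ij; case: (block_ports u (g_proper (jA := shift a i) erefl ij)).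
have gv i u : (vv, u) \in base_edges -> g i vv u != s i.
  by case: (block_ports u (gi i)) => _ _ _ _ [].
have gv' i u : (u, vv) \in base_edges -> g i u vv != s i.
  by case: (block_ports u (gi i)) => _ _ _ _ [].
apply: (@edge_colorable_arcs _ (@Galpha_arc m a b c) _ arc_color).
(* Keeping the shared endpoint as an equation lets both arcs be analyzed by kind. In [base_edges],
   [A] is a source and [B], [A'], [B'] are sinks, which makes several mixed cases void here and
   below. *)
- suff out p q k p' q' k' : colored_arc p q k -> colored_arc p' q' k' ->
      p = p' -> q != q' -> k != k'.
    by move=> x y z /arc_colorP xy /arc_colorP xz; apply: out xy xz _.
  case=> [u u' i uu'|i j ij|i j ij|i|i j ij];
  case=> [v v' i' vv'|i' j' ij'|i' j' ij'|i'|i' j' ij'] // [].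
  + move=> ? ?; subst v i' => neq; apply: (block_out (gi i)) => //.
    by apply: contraNneq neq => ->.
  + by move=> uE; move: uu'; rewrite uE; case: u'.
  + by move=> uE; move: uu'; rewrite uE; case: u'.
  + by move=> uE <- _; rewrite uE in uu' *; apply: gv.
  + by move=> vE; move: vv'; rewrite -vE; case: v'.
  + move=> ii' /eqP[]; congr (inl (_, _)); apply: val_inj.
    by rewrite /= ij ij' ii'.
  + by move=> vE; move: vv'; rewrite -vE; case: v'.
  + move=> ii' /eqP[]; congr (inl (_, _)); apply: val_inj.
    by rewrite /= ij ij' ii'.
  + by move=> vE <- _; rewrite -vE in vv' *; rewrite eq_sym; apply: gv.
  + by move=> -> /eqP.
  + by move=> ii' /eqP[]; congr inr; apply: val_inj; rewrite /= ij ij' ii'.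
- suff inn p q k p' q' k' : colored_arc p q k -> colored_arc p' q' k' ->
      q = q' -> p != p' -> k != k'.
    by move=> x y z /arc_colorP xy /arc_colorP xz; apply: inn xy xz _.
  case=> [u u' i uu'|i j ij|i j ij|i|i j ij];
  case=> [v v' i' vv'|i' j' ij'|i' j' ij'|i'|i' j' ij'] // [].
  + move=> ? ?; subst v' i' => neq; apply: (block_in (gi i)) => //.
    by apply: contraNneq neq => ->.
  + by move=> uE <- _; rewrite uE in uu' *; move: uu'; case: (u).
  + by move=> uE <- _; rewrite uE in uu' *; apply: gB.
  + by move=> vE -> _; rewrite -vE in vv' *; move: vv'; case: (v).
  + by move=> jj' /eqP[]; rewrite jj' in ij; rewrite (modD_inj ij ij').
  + by move=> vE -> _; rewrite -vE in vv' *; rewrite eq_sym; apply: gB.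
  + by move=> jj' /eqP[]; rewrite jj' in ij; rewrite (modD_inj ij ij').
  + by move=> -> /eqP.
  + by move=> -> _; have [_ /(_ _ ij')/andP[]] := loop_proper j'.
  + by move=> <- _; rewrite eq_sym; have [_ /(_ _ ij)/andP[]] := loop_proper j.
  + by move=> jj' /eqP[]; rewrite jj' in ij; rewrite (modD_inj ij ij').
- suff thru p q k p' q' k' : colored_arc p q k -> colored_arc p' q' k' ->
      p = q' -> k != k'.
    by move=> x y z /arc_colorP xy /arc_colorP xz; apply: thru xy xz _.
  case=> [u u' i uu'|i j ij|i j ij|i|i j ij];
  case=> [v v' i' vv'|i' j' ij'|i' j' ij'|i'|i' j' ij'] // [].
  + by move=> ? ?; subst v' i'; apply: (block_thru (gi i)).
  + by move=> uE <-; rewrite uE in uu' *; apply: gA.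
  + by move=> uE <-; rewrite uE in uu' *; move: uu'; case: (u').
  + by move=> vE <-; rewrite -vE in vv' *; rewrite eq_sym; apply: gA'.
  + by move=> vE <-; rewrite -vE in vv' *; rewrite eq_sym; apply: gB'.
  + by move=> vE <-; rewrite -vE in vv' *; rewrite eq_sym; apply: gv'.
  + by move=> ->; rewrite eq_sym; have [] := loop_proper i'.
  + by move=> ->; have [_ /(_ _ ij')/andP[]] := loop_proper j'.
Qed.
End Assembly.

(** * Colors of spokes and loop edges *)

Definition spoke_color (c i : nat) : 'I_3 :=
  if i == 0 then c1 else if i == c then c0 else c2.

Lemma modn_succ (m i : nat) :
  i < m -> (i + 1) %% m = if i == m.-1 then 0 else i.+1.
Proof.
move=> lt_im; case: eqP => [->|?]; last by rewrite modn_small; lia.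
by rewrite addn1 prednK ?modnn //; lia.
Qed.

Lemma loop_coloring (m c : nat) : odd m -> 0 < c < m -> coprime c m ->
  exists lc : nat -> 'I_3, forall i, i < m ->
    let j := (i + c) %% m in uniq [:: spoke_color c j; lc i; lc j].
Proof.
move=> m_odd /andP[c_gt0 lt_cm] /(coprimeP _ c_gt0)[[r t] /= rt].
(* Bezout gives an inverse [r] of [c] modulo [m]; multiplication by [r] turns steps of [c] into
   steps of 1. *)
have rc : r * c = 1 %[mod m].
  by have -> : r * c = t * m + 1 by [lia]; rewrite modnMDl.
(* The position of [w_i] on the cycle [w_0, w_c, w_2c, ...]. *)
pose k i := (i * r) %% m.
have m_gt1 : 1 < m by apply: leq_ltn_trans lt_cm.
have kK i : i < m -> (k i * c) %% m = i.
  move=> lt_im; rewrite /k modnMml -mulnA -modnMmr rc modnMmr muln1.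
  exact: modn_small.
have kS i : k ((i + c) %% m) = (k i + 1) %% m.
  by rewrite /k modnMml mulnDl -modnDmr [c * r]mulnC rc modnDmr modnDml.
have spokeE j : j < m -> spoke_color c j =
    if k j == 0 then c1 else if k j == 1 then c0 else c2.
  move=> lt_jm; have <- : (j == 0) = (k j == 0).
    apply/eqP/eqP => [->|k0]; first by rewrite /k mul0n mod0n.
    by rewrite -(kK j lt_jm) k0 mul0n mod0n.
  have <- // : (j == c) = (k j == 1).
  apply/eqP/eqP => [->|k1]; first by rewrite /k mulnC rc modn_small.
  by rewrite -(kK j lt_jm) k1 mul1n modn_small.
(* Since [m] is odd, the last position [m.-1] is even, so the edge returning to [w_0] has color 0
   and leaves color 1 for the spoke there. *)
exists (fun i => if k i == 0 then c2 else if odd (k i) then c1 else c0).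
move=> i lt_im /=; rewrite spokeE ?ltn_pmod ?(ltnW m_gt1) // kS.
have lt_km : k i < m by rewrite ltn_pmod // ltnW.
clear -m_odd m_gt1 lt_km; rewrite modn_succ //; move: (k i) lt_km => n lt_nm.
case: (n =P m.-1) => ?; repeat case: ifP => // ?; lia.
Qed.

(* The closed walk of states *)
Create HintDb transitions discriminated.
Hint Constants Opaque : transitions.
Hint Resolve transition1_01_21 transition0_20_10 transition1_21_01
  transition0_10_20 transition2_21_20 transition2_20_21
  transition2_10_22 transition2_22_01 transition2_01_22
  transition2_22_10 : transitions.

Lemma closed_walk (m c : nat) : odd m -> 1 < c -> 2 * c < m ->
  exists st : nat -> 'I_3 * 'I_3, forall i, i < m ->
    block_transition (spoke_color c i) (st i) (st ((i + 1) %% m)).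
Proof.
move=> m_odd c_gt1 lt_2cm.
have [c_odd|c_even] := boolP (odd c).
(* The walk is 21, 01, then 22 and 10 alternately up to 10 at [c], then 20 and 21 alternately. It
   closes because [m.-1] is even: its state 20 leads back to 21. *)
- exists (fun i => if i == 0 then (c2, c1) else if i == 1 then (c0, c1) else
    if i <= c then if odd i then (c1, c0) else (c2, c2) else
    if odd i then (c2, c1) else (c2, c0)) => i lt_im.
  (* Each branch is one of the ten transitions or has contradictory conditions on order and
     parity. *)
  rewrite modn_succ // /spoke_color; repeat case: ifP; intros;
    first [solve [auto with transitions nocore] | lia].
(* The walk is 01, then 21 and 20 alternately up to 20 at [c], then 10, then 22 and 01 alternately.
   The state 22 at the even index [m.-1] leads back to 01; [2 * c < m] ensures that [m.-1] exceeds
   [c.+1]. *)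
- exists (fun i => if i == 0 then (c0, c1) else
    if i <= c then if odd i then (c2, c1) else (c2, c0) else
    if i == c.+1 then (c1, c0) else
    if odd i then (c0, c1) else (c2, c2)) => i lt_im.
  rewrite modn_succ // /spoke_color; repeat case: ifP; intros;
    first [solve [auto with transitions nocore] | lia].
Qed.

Theorem theorem7 (m c : nat) (hm : odd m) (hc1 : 1 < c) (hcm : 2 * c < m)
    (hgcd : gcdn c m = 1) :
  edge_colorable (@Galpha m 1 1 c) 3.
Proof.
have c_range : 0 < c < m by lia.
have co_cm : coprime c m by apply/eqP.
have [lc lcP] := loop_coloring hm c_range co_cm.
have [st stP] := closed_walk hm hc1 hcm.
have [g gP] := fin_all_exists (fun i : 'I_m => stP i (ltn_ord i)).
apply: (@edge_colorable_blocks m 1 1 c (fun i => spoke_color c i)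
  (fun i => (st i).1) (fun i => (st i).2) (fun i => lc i) g).
- by move=> i jA jB -> ->; rewrite -!surjective_pairing; apply: gP.
- by move=> i j ->; apply: lcP.
Qed.
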